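(* Let $m\ge 2$ and let $q_1,\dots,q_m$ be nonzero integers. Let $A$ be the $m\times m$ matrix whose first row is $(1,1,\dots,1)$ and whose $i$-th row, for $2\le i\le m$, has entry $-q_1$ in column $1$, entry $q_i$ in column $i$, and $0$ in all other columns. Then $$\det A=q_1q_2\cdots q_m\left(\frac1{q_1}+\frac1{q_2}+\cdots+\frac1{q_m}\right).$$
   Context: The matrix $A$ is the coefficient matrix of the linear system $d_1+\cdots+d_m=0$, $-q_1d_1+q_id_i=0$ ($2\le i\le m$), associated to the pretzel knot $P(q_1,\dots,q_m)$ with $m$ twist regions, the $i$-th of which has $q_i$ half-twists ($q_i$ may be positive or negative). *)

(* Defs.v *)
From mathcomp Require Import all_boot all_order all_algebra.

Set Implicit Arguments.
Unset Strict Implicit.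
Unset Printing Implicit Defensive.

Import GRing.Theory Num.Theory.
Local Open Scope ring_scope.

(* Indices are 0-based: the twist regions 1, ..., m are 0, ..., m - 1 in 'I_m. *)
Definition first_ord (m : nat) (hm : (1 < m)%N) : 'I_m := Ordinal (ltnW hm).

(* Coefficient matrix of d_1 + ... + d_m = 0, - q_1 d_1 + q_i d_i = 0 (i >= 2). *)
Definition pretzel_mx (m : nat) (hm : (1 < m)%N) (q : 'I_m -> int) : 'M[int]_m :=
  \matrix_(i < m, j < m)
    if i == first_ord hm then 1
    else if j == first_ord hm then - q (first_ord hm)
    else if j == i then q i
    else 0.

(* Main.v *)
Require Import Defs.
From mathcomp Require Import all_boot all_order all_algebra.

Import GRing.Theory Num.Theory.
Local Open Scope ring_scope.

(** Number rows and columns from 0, and work over a field in which the [q i]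
    are invertible.  Adding [q 0 / q i] times column [i] to column [0], for
    every [i > 0], clears the entries [- q 0] below the corner and turns the
    corner into [q 0 * \sum_i 1 / q i].  The result is upper triangular with
    the other diagonal entries still [q i], and the operation does not change
    the determinant; [det_pretzel_field] follows.  The integer matrix is
    handled by embedding it in the rationals. *)

(** Right multiplication by this lower unitriangular matrix is the column
    operation; its entry at [(0, 0)] is [q 0 / q 0 = 1]. *)
Definition clearing_mx (F : fieldType) (n : nat) (q : 'I_n.+1 -> F) :
    'M[F]_n.+1 :=
  \matrix_(i, j) if j == ord0 then q ord0 / q i else (i == j)%:R.

Lemma det_clearing_mx (F : fieldType) (n : nat) (q : 'I_n.+1 -> F) :
  q ord0 != 0 -> \det (clearing_mx F n q) = 1.
Proof.
move=> q0; rewrite det_trig.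
  apply: big1 => i _; rewrite mxE; case: eqP => [->|_]; first exact: divff.
  by rewrite eqxx.
apply/is_trig_mxP => i j lt_ij; rewrite mxE.
case: eqP => [j0|_]; first by rewrite j0 in lt_ij.
by case: eqP => // eq_ij; rewrite eq_ij ltnn in lt_ij.
Qed.

Lemma det_pretzel_field (F : fieldType) (n : nat) (q : 'I_n.+1 -> F) :
  (forall i, q i != 0) ->
  \det (\matrix_(i < n.+1, j < n.+1)
          if i == ord0 then 1
          else if j == ord0 then - q ord0
          else if j == i then q i
          else 0)
    = (\prod_i q i) * (\sum_i 1 / q i).
Proof.
move=> q_neq0; set A := \matrix_(i, j) _.
pose B : 'M[F]_n.+1 := \matrix_(i, j)
  if i == ord0 then if j == ord0 then q ord0 * \sum_k 1 / q k else 1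
  else if i == j then q i else 0.
have AL : A *m clearing_mx F n q = B.
  apply/matrixP => i j; rewrite !mxE.
  have [->|i0] := eqVneq i ord0.
    have [->|j0] := eqVneq j ord0.
      rewrite mulr_sumr; apply: eq_bigr => k _.
      by rewrite !mxE /= mul1r div1r.
    rewrite (bigD1 j) //= !mxE /= (negPf j0) eqxx mulr1 big1 ?addr0 // => k kj.
    by rewrite !mxE (negPf j0) (negPf kj) mulr0.
  (* Row [i > 0] of [A] is supported on columns [0] and [i]. *)
  rewrite (bigD1 ord0) // (bigD1 i) //= !mxE (negPf i0) !eqxx.
  rewrite big1 ?addr0 => [|k /andP[k0 ki]]; last first.
    by rewrite mxE (negPf i0) (negPf k0) (negPf ki) mul0r.
  have [->|j0] := eqVneq j ord0.
    by rewrite (negPf i0) divff // mulr1 mulrC divfK // addNr.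
  rewrite mulr0 add0r.
  by case: eqP; rewrite ?mulr1 ?mulr0.
have <- : \det (A *m clearing_mx F n q) = \det A.
  by rewrite det_mulmx det_clearing_mx // mulr1.
(* [det_trig] is about lower triangular matrices, and [B] is upper triangular. *)
rewrite AL -det_tr det_trig; last first.
  apply/is_trig_mxP => i j lt_ij; rewrite !mxE.
  case: eqP => [j0|_]; first by rewrite j0 in lt_ij.
  by case: eqP => // eq_ij; rewrite eq_ij ltnn in lt_ij.
rewrite big_ord_recl [\prod_i q i]big_ord_recl !mxE /= mulrAC.
by congr (_ * _ * _); apply: eq_bigr => i _; rewrite !mxE eqxx.
Qed.

Theorem claim17 (m : nat) (hm : (2 <= m)%N) (q : 'I_m -> int)
    (hq : forall i : 'I_m, q i != 0) :
  (\det (pretzel_mx hm q))%:~R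
    = (\prod_(i < m) (q i)%:~R) * (\sum_(i < m) 1 / (q i)%:~R) :> rat.
Proof.
case: m hm q hq => // n hm q hq.
rewrite -det_map_mx -det_pretzel_field => [|i]; last by rewrite intr_eq0.
have e0 : first_ord hm = ord0 by apply: val_inj.
congr (\det _); apply/matrixP => i j; rewrite !mxE e0.
case: ifP => // _; case: ifP => _; first by rewrite rmorphN.
by case: ifP.
Qed.
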